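(* Let $\overline{A}=(A_1,\dots,A_X)$ and $\overline{A}'=(A'_1,\dots,A'_{X'})$ be two cardinalities with associated spaces $\mathcal{A}$ and $\mathcal{A}'$, and let $\Lambda:\mathcal{A}\to\mathcal{A}'$ be a linear map. Then $\Lambda$ is a causal local transformation if and only if $\Lambda$ is a completely positive local transformation.
   Context: A cardinality $\overline{A}=(A_1,\dots,A_X)$ is a finite nonempty sequence of positive integers: a device has inputs $x\in\{1,\dots,X\}$ and, for input $x$, outputs $a\in\{1,\dots,A_x\}$. The associated space is $\mathcal{A}=\mathbb{R}^{d}$ with $d=\sum_x A_x$, whose coordinates are indexed by pairs $(a,x)$ with $1\le x\le X$, $1\le a\le A_x$; the coordinate of $\vec P\in\mathcal{A}$ is written $P(a|x)$. For two devices with spaces $\mathcal{A},\mathcal{B}$, elements of $\mathcal{A}\otimes\mathcal{B}$ have coordinates $P(ab|xy)$. The set $(\mathcal{A}\otimes\mathcal{B})^{\Sigma+}$ of normalized nonnegative behaviors consists of the $\vec P\in\mathcal{A}\otimes\mathcal{B}$ with $P(ab|xy)\ge 0$ for all $a,b,x,y$ and $\sum_{a,b}P(ab|xy)=1$ for all $x,y$ (no nonsignaling condition is imposed). A linear map $\Lambda:\mathcal{A}\to\mathcal{A}'$ is given by its matrix $\Lambda_{(a',x'),(a,x)}$, acting by $P'(a'|x')=\sum_{x=1}^{X}\sum_{a=1}^{A_x}\Lambda_{(a',x'),(a,x)}P(a|x)$. Causal local transformation: there exist conditional probability distributions $\mathrm{P}(x|x')$ (for each $x'$, a probability distribution over $x\in\{1,\dots,X\}$)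 and $\mathrm{P}(a'|x,a,x')$ (for each $x'$, $x$ and $a\in\{1,\dots,A_x\}$, a probability distribution over $a'\in\{1,\dots,A'_{x'}\}$) such that $\Lambda_{(a',x'),(a,x)}=\mathrm{P}(x|x')\,\mathrm{P}(a'|x,a,x')$ for all indices. Completely positive local transformation: for every cardinality $\overline{B}$ with space $\mathcal{B}$ and every $\vec P\in(\mathcal{A}\otimes\mathcal{B})^{\Sigma+}$ (including those signaling between the devices), one has $(\Lambda\otimes\mathrm{id}_{\mathcal{B}})\vec P\in(\mathcal{A}'\otimes\mathcal{B})^{\Sigma+}$. *)

(* Defs.v *)
From HB Require Import structures.
From mathcomp Require Import all_boot all_order all_algebra.
From mathcomp Require Import reals.

Set Implicit Arguments.
Unset Strict Implicit.
Unset Printing Implicit Defensive.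

Import Order.TTheory GRing.Theory Num.Theory.
Local Open Scope ring_scope.

Record cardinality := Cardinality {
  inputs : nat;
  outputs : 'I_inputs -> nat;
  inputs_gt0 : (0 < inputs)%N;
  outputs_gt0 : forall x, (0 < outputs x)%N }.

(* Inputs and outputs are numbered from 0. *)
Definition coordinate (A : cardinality) : finType :=
  {x : 'I_(inputs A) & 'I_(outputs x)}.

(* [a \given x] is the coordinate of P(a|x). *)
Definition at_coord (A : cardinality) (x : 'I_(inputs A)) (a : 'I_(outputs x)) :
  coordinate A := existT _ x a.

Notation "a '\given' x" := (@at_coord _ x a)
  (at level 60, no associativity) : ring_scope.

(* [GRing.regular R] is R seen as a module over itself, which makes R^I an
   lmodType. *)
Notation coord_space R I := {ffun I -> GRing.regular R}.

Section LinearMaps.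
Variable R : realType.

Definition basis_vec (I : finType) (i : I) : coord_space R I :=
  [ffun j => (j == i)%:R].

Definition entry (I J : finType) (L : {linear coord_space R I -> coord_space R J})
  (j : J) (i : I) : R := L (basis_vec i) j.

Lemma linear_entryE (I J : finType) (L : {linear coord_space R I -> coord_space R J})
    (P : coord_space R I) (j : J) :
  L P j = \sum_i entry L j i * (P i : R).
Proof.
have {1}-> : P = \sum_i (P i : R) *: basis_vec i.
  apply/ffunP => k; rewrite sum_ffunE (bigD1 k) //= !ffunE eqxx.
  rewrite big1 ?addr0 => [|i /negPf ik]; first by rewrite /GRing.scale /= mulr1.
  by rewrite !ffunE eq_sym ik /GRing.scale /= mulr0.
rewrite linear_sum sum_ffunE; apply: eq_bigr => i _.
by rewrite linearZ ffunE /entry /GRing.scale /= mulrC.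
Qed.

(* The tensor product of the coordinate spaces over I and J is identified with
   the coordinate space over I * J, and that of linear maps with the Kronecker
   product of their matrices. *)
Definition tensor_vec (I J : finType) (u : coord_space R I) (v : coord_space R J) :
    coord_space R (I * J)%type :=
  [ffun p => (u p.1 : R) * v p.2].

Definition tensor_map (I I' J J' : finType)
    (L : {linear coord_space R I -> coord_space R I'})
    (M : {linear coord_space R J -> coord_space R J'})
    (P : coord_space R (I * J)%type) : coord_space R (I' * J')%type :=
  [ffun q => \sum_(p : I * J) entry L q.1 p.1 * entry M q.2 p.2 * (P p : R)].

Lemma tensor_map_vec (I I' J J' : finType)
    (L : {linear coord_space R I -> coord_space R I'})
    (M : {linear coord_space R J -> coord_space R J'}) (u : coord_space R I) (v : coord_space R J) :
  tensor_map L M (tensor_vec u v) = tensor_vec (L u) (M v).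
Proof.
apply/ffunP => -[i' j']; rewrite !ffunE /= !linear_entryE big_distrlr /=.
rewrite pair_bigA /=; apply: eq_bigr => -[i j] _.
by rewrite ffunE /= mulrACA.
Qed.

Lemma tensor_map_idE (I I' J : finType)
    (L : {linear coord_space R I -> coord_space R I'})
    (P : coord_space R (I * J)%type) (i' : I') (j : J) :
  tensor_map L (idfun : {linear coord_space R J -> coord_space R J}) P (i', j) =
    \sum_i entry L i' i * (P (i, j) : R).
Proof.
rewrite ffunE (eq_bigr (fun p : I * J =>
    entry L i' p.1 * (p.2 == j)%:R * (P (p.1, p.2) : R))); last first.
  by case=> i k _ /=; rewrite [entry idfun _ _]/entry ffunE eq_sym.
rewrite -(pair_bigA _ (fun i k =>
    entry L i' i * (k == j)%:R * (P (i, k) : R))) /=.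
apply: eq_bigr => i _; rewrite (bigD1 j) //= eqxx mulr1 big1 ?addr0 //.
by move=> k /negPf ->; rewrite mulr0 mul0r.
Qed.

End LinearMaps.

Definition is_distribution (R : realType) (I : finType) (p : I -> R) : Prop :=
  (forall i, 0 <= p i) /\ \sum_i p i = 1.

Definition normalized_nonneg (R : realType) (A B : cardinality)
    (P : coord_space R (coordinate A * coordinate B)%type) : Prop :=
  (forall x (a : 'I_(outputs x)) y (b : 'I_(outputs y)),
     0 <= (P (a \given x, b \given y) : R)) /\
  (forall (x : 'I_(inputs A)) (y : 'I_(inputs B)),
     \sum_(a < outputs x) \sum_(b < outputs y)
       (P (a \given x, b \given y) : R) = 1).

(* [p x' x] is P(x|x') and [q x' x a a'] is P(a'|x,a,x'). *)
Definition causal_map (R : realType) (A A' : cardinality)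
    (L : {linear coord_space R (coordinate A) -> coord_space R (coordinate A')}) : Prop :=
  exists (p : 'I_(inputs A') -> 'I_(inputs A) -> R)
         (q : forall (x' : 'I_(inputs A')) (x : 'I_(inputs A)),
                'I_(outputs x) -> 'I_(outputs x') -> R),
    [/\ forall x', is_distribution (p x'),
        forall x' x a, is_distribution (q x' x a)
      & forall x' a' x a,
          entry L (a' \given x') (a \given x) = p x' x * q x' x a a'].

Definition completely_positive_map (R : realType) (A A' : cardinality)
    (L : {linear coord_space R (coordinate A) -> coord_space R (coordinate A')}) : Prop :=
  forall (B : cardinality) (P : coord_space R (coordinate A * coordinate B)%type),
    normalized_nonneg P ->
    normalized_nonneg
      (tensor_map L
         (idfun : {linear coord_space R (coordinate B)
                          -> coord_space R (coordinate B)}) P).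

(* Main.v *)
Require Import Defs.
From HB Require Import structures.
From mathcomp Require Import all_boot all_order all_algebra.
From mathcomp Require Import reals.

(** A causal map is completely positive by direct summation. Conversely, probe a completely positive map with a second device having one
    input and two outputs, fed with deterministic behaviors
    P(ab|x) = [a = f x] [b = g x]. Taking for g the indicator of a single input
    x (a signaling behavior) isolates one entry of the matrix, which is
    therefore nonnegative. Normalization says that the column sums
    S(x', x, a) = sum_a' L(a'x', ax) satisfy sum_x S(x', x, f x) = 1 for every
    f; changing f at one input shows that S(x', x, a) does not depend on a, so it
    is the wanted P(x|x'), and P(a'|x,a,x') is the quotient L / S. *)

Set Implicit Arguments.
Unset Strict Implicit.
Unset Printing Implicit Defensive.

Import Order.TTheory GRing.Theory Num.Theory.
Local Open Scope ring_scope.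

Lemma sum_coordinate (V : nmodType) (A : cardinality) (F : coordinate A -> V) :
  \sum_i F i = \sum_(x < inputs A) \sum_(a < outputs x) F (a \given x).
Proof. by rewrite sig_big_dep /=; apply: eq_bigr => -[]. Qed.

Definition default_output (A : cardinality) (x : 'I_(inputs A)) :
  'I_(outputs x) := Ordinal (outputs_gt0 x).

Lemma distribution_delta (R : realType) (I : finType) (i : I) :
  is_distribution (fun j => (j == i)%:R : R).
Proof.
split=> [j|]; first exact: ler0n.
by rewrite (bigD1 i) //= eqxx big1 ?addr0 // => j /negPf ->.
Qed.

Lemma distribution_normalize (R : realType) (I : finType) (w : I -> R) :
  (forall i, 0 <= w i) -> \sum_i w i != 0 ->
  is_distribution (fun i => w i / \sum_j w j).
Proof.
move=> w_ge0 w_neq0; split=> [i|]; first by rewrite divr_ge0 ?sumr_ge0.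
by rewrite -mulr_suml divff.
Qed.

Definition bit_device : cardinality :=
  @Cardinality 1 (fun _ => 2) isT (fun _ => isT).

Definition bit_input : 'I_(inputs bit_device) := @ord0 0.

Definition bit_output (b : bool) : 'I_(outputs bit_input) := inord b.

Section CausalIsCompletelyPositive.
Variables (R : realType) (A A' : cardinality).
Variable L : {linear coord_space R (coordinate A) -> coord_space R (coordinate A')}.

Lemma causal_completely_positive : causal_map L -> completely_positive_map L.
Proof.
case=> p [q [p_distr q_distr LE]] B P [P_ge0 P_sum1]; split=> [x' a' y b|x' y].
  rewrite tensor_map_idE sum_coordinate.
  apply: sumr_ge0 => x _; apply: sumr_ge0 => a _; rewrite LE.
  by rewrite !mulr_ge0 ?P_ge0 ?(p_distr x').1 ?(q_distr x' x a).1.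
(* Writing the right-hand 1 as the sum of [p x' x] over [x] lets the identity be proved input by
   input, once the sum over [x] is moved outermost. *)
rewrite -[RHS](p_distr x').2.
under eq_bigr => a' _.
  under eq_bigr => b _ do rewrite tensor_map_idE sum_coordinate.
  rewrite exchange_big /=.
  under eq_bigr => x _ do rewrite exchange_big /=.
  over.
rewrite exchange_big /=; apply: eq_bigr => x _.
(* Normalization of [P] is needed only at each fixed pair [(x, y)], so signaling is harmless. *)
rewrite -[RHS]mulr1 -(P_sum1 x y) mulr_sumr exchange_big /=.
apply: eq_bigr => a _.
rewrite exchange_big /= mulr_sumr; apply: eq_bigr => b _.
rewrite -mulr_suml; congr (_ * _).
under eq_bigr => a' _ do rewrite LE.
by rewrite -mulr_sumr (q_distr x' x a).2 mulr1.
Qed.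

End CausalIsCompletelyPositive.

Section CompletelyPositiveIsCausal.
Variables (R : realType) (A A' : cardinality).
Variable L : {linear coord_space R (coordinate A) -> coord_space R (coordinate A')}.
Hypothesis L_cp : completely_positive_map L.

Definition deterministic (f : forall x : 'I_(inputs A), 'I_(outputs x))
    (g : 'I_(inputs A) -> bool) :
    coord_space R (coordinate A * coordinate bit_device)%type :=
  [ffun c => ((tagged c.1 == f (tag c.1))
              && (c.2 == (bit_output (g (tag c.1)) \given bit_input)))%:R].

Lemma deterministicE f g x (a : 'I_(outputs x)) (b : 'I_(outputs bit_input)) :
  deterministic f g (a \given x, b \given bit_input) =
  (a == f x)%:R * (b == bit_output (g x))%:R :> R.
Proof. by rewrite ffunE /= -mulnb natrM eq_Tagged. Qed.

Lemma deterministic_normalized f g : normalized_nonneg (deterministic f g).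
Proof.
split=> [x a y b|x y]; first by rewrite ffunE ler0n.
have -> : y = bit_input by apply: val_inj; case: y => -[].
under eq_bigr => a _.
  under eq_bigr => b _ do rewrite deterministicE.
  rewrite -mulr_sumr (distribution_delta R (bit_output (g x))).2 mulr1; over.
exact: (distribution_delta R (f x)).2.
Qed.

Lemma tensor_deterministic f g (c' : coordinate A') b :
  tensor_map L
    (idfun : {linear coord_space R (coordinate bit_device)
                     -> coord_space R (coordinate bit_device)})
    (deterministic f g) (c', b \given bit_input) =
  \sum_x entry L c' (f x \given x) * (b == bit_output (g x))%:R :> R.
Proof.
rewrite tensor_map_idE sum_coordinate; apply: eq_bigr => x _.
rewrite (bigD1 (f x)) //= deterministicE eqxx mul1r big1 ?addr0 //.
by move=> a /negPf af; rewrite deterministicE af mul0r mulr0.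
Qed.

Lemma entry_ge0 (c' : coordinate A') (c : coordinate A) : 0 <= entry L c' c.
Proof.
case: c' c => x' a' [x a].
(* The strategy answers [a] at [x] and a default elsewhere; the bit is true exactly when the input
   is [x], so reading true keeps only the entry at [(a, x)]. *)
have [ge0 _] := L_cp (deterministic_normalized
  (dfwith (@default_output A) a) (pred1 x)).
have := ge0 x' a' bit_input (bit_output true).
rewrite tensor_deterministic (bigD1 x) //= dfwith_in !eqxx mulr1 big1 ?addr0 //.
move=> z /negPf zx; rewrite zx -val_eqE /= !inordK //.
by rewrite mulr0.
Qed.

Definition column_sum (x' : 'I_(inputs A')) x (a : 'I_(outputs x)) : R :=
  \sum_(a' < outputs x') entry L (a' \given x') (a \given x).

Lemma sum_column_sum x' (f : forall x : 'I_(inputs A), 'I_(outputs x)) :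
  \sum_x column_sum x' (f x) = 1.
Proof.
(* The bit is summed out, so a constant one suffices. *)
have [_ sum1] := L_cp (deterministic_normalized f xpred0).
rewrite -(sum1 x' bit_input) exchange_big /=; apply: eq_bigr => a' _.
under [RHS]eq_bigr => b _ do rewrite tensor_deterministic.
rewrite exchange_big /=; apply: eq_bigr => x _.
by rewrite -mulr_sumr (distribution_delta R (bit_output false)).2 mulr1.
Qed.

Lemma column_sum_const x' x (a b : 'I_(outputs x)) :
  column_sum x' a = column_sum x' b.
Proof.
have sumE c := sum_column_sum x' (dfwith (@default_output A) (c : 'I_(outputs x))).
have /eqP := etrans (sumE a) (esym (sumE b)).
rewrite (bigD1 x) //= [X in _ == X](bigD1 x) //= !dfwith_in.
(* The two strategies differ only at [x], so all other terms cancel. *)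
have -> : \sum_(z | z != x) column_sum x' (dfwith (@default_output A) a z) =
          \sum_(z | z != x) column_sum x' (dfwith (@default_output A) b z).
  by apply: eq_bigr => z zx; rewrite !dfwith_out // eq_sym.
by rewrite (can_eq (addrK _)) => /eqP.
Qed.

Lemma completely_positive_causal : causal_map L.
Proof.
(* A zero column cannot be normalized; there [p] vanishes, and a point mass serves as an arbitrary
   distribution. *)
pose q x' x (a : 'I_(outputs x)) : 'I_(outputs x') -> R :=
  if column_sum x' a == 0 then fun a' => (a' == default_output x')%:R
  else fun a' => entry L (a' \given x') (a \given x) / column_sum x' a.
exists (fun x' x => column_sum x' (default_output x)), q.
split=> [x'|x' x a|x' a' x a].
- split=> [x|]; last exact: sum_column_sum.
  by apply: sumr_ge0 => a' _; apply: entry_ge0.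
- rewrite /q; case: ifPn => [_|S_neq0]; first exact: distribution_delta.
  by apply: distribution_normalize => // a'; apply: entry_ge0.
rewrite (column_sum_const x' (default_output x) a) /q; case: ifPn => [S0|S_neq0].
  rewrite (eqP S0) mul0r.
  (* Nonnegative entries with zero sum all vanish, which matches the zero product. *)
  by move/eqP/psumr_eq0P: S0 => -> // c' _; apply: entry_ge0.
by rewrite mulrC divfK.
Qed.

End CompletelyPositiveIsCausal.

Theorem proposition1 (R : realType) (A A' : cardinality)
    (L : {linear coord_space R (coordinate A) -> coord_space R (coordinate A')}) :
  causal_map L <-> completely_positive_map L.
Proof.
split; [exact: causal_completely_positive | exact: completely_positive_causal].
Qed.
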